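(* Let $(\underline F,\overline F)$ be a p-box on a totally preordered space $(\Omega,\preceq)$ with smallest element $0_\Omega$ and largest element $1_\Omega$, with $0$–$1$-valued $\underline F$, and let $B=\{x\in\Omega^*:\underline F(x)=0\}$ and $B^c=\Omega^*\setminus B$. Then, for any $A\subseteq\Omega$, $$\overline E_{\underline F,\overline F}(A)=\begin{cases}\displaystyle\inf_{x\in\Omega^*:\,A\cap B\preceq x}\overline F(x) & \text{if } y\prec A\cap B^c\text{ for at least one }y\in B^c,\\ 1 & \text{otherwise,}\end{cases}$$ and also $$\overline E_{\underline F,\overline F}(A)=\min_{y\in B^c}\ \inf_{x\in\Omega^*:\,A\cap[0_\Omega,y]\preceq x}\overline F(x)$$ (in particular the minimum over $y$ is attained).
   Context: A total preorder $\preceq$ is reflexive, transitive, with any two elements comparable; $x\prec y$ means $x\preceq y$ and not $y\preceq x$. A formal element $0_\Omega-$ is added: $\Omega^*=\Omega\cup\{0_\Omega-\}$ with $0_\Omega-\prec x$ for all $x\in\Omega$. For a set $S$, $S\preceq x$ means $z\preceq x$ for all $z\in S$, and $y\prec S$ means $y\prec z$ for all $z\in S$ (both hold vacuously for $S=\emptyset$). $[0_\Omega,y]=\{z\in\Omega:z\preceq y\}$. A cumulative distribution function is a non-decreasing map $F:\Omega\to[0,1]$ with $F(1_\Omega)=1$, extended to $\Omega^*$ by $F(0_\Omega-)=0$. A p-box is a pair $(\underline F,\overline F)$ of cumulative distribution functions with $\underline F\le\overline F$. $F$ is $0$–$1$-valued if it takes only the values $0$ and $1$. The natural extension of the p-box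 is $\overline E_{\underline F,\overline F}(A)=\sup P(A)$ for $A\subseteq\Omega$, the supremum being over all finitely additive probabilities $P$ on the power set of $\Omega$ with $\underline F(x)\le P([0_\Omega,x])\le\overline F(x)$ for all $x\in\Omega$. *)

(* Defs.v *)
From HB Require Import structures.
From mathcomp Require Import all_boot all_order all_algebra.
From mathcomp Require Import boolp classical_sets reals.

Set Implicit Arguments.
Unset Strict Implicit.
Unset Printing Implicit Defensive.

Import Order.Theory GRing.Theory Num.Theory.

Local Open Scope classical_set_scope.
Local Open Scope ring_scope.

(** [star T] is the preordered set [T] with a new element [0-], encoded as
    [None], put strictly below every element of [T]. *)
Definition star (d : Order.disp_t) (T : preorderType d) : Type := option T.

Definition to_star (d : Order.disp_t) (T : preorderType d) : T -> star T :=
  Some.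

Definition star_le (d : Order.disp_t) (T : preorderType d) : rel (star T) :=
  fun x y => match x, y with
             | None, _ => true
             | Some _, None => false
             | Some a, Some b => (a <= b)%O
             end.

Lemma star_le_refl (d : Order.disp_t) (T : preorderType d) :
  reflexive (@star_le d T).
Proof. by case=> [a|] //=; exact: lexx. Qed.

Lemma star_le_trans (d : Order.disp_t) (T : preorderType d) :
  transitive (@star_le d T).
Proof. by case=> [b|] [a|] [c|] //=; exact: le_trans. Qed.

HB.instance Definition _ (d : Order.disp_t) (T : preorderType d) :=
  Choice.copy (star T) (option T).

(* The strict order this provides is [(x <= y) && ~~ (y <= x)]. *)
HB.instance Definition _ (d : Order.disp_t) (T : preorderType d) :=
  Order.Le_isPreorder.Build d (star T) (@star_le_refl d T) (@star_le_trans d T).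

(* The library's [ubound] requires an antisymmetric order. *)
Definition set_le (d : Order.disp_t) (T : preorderType d) (S : set T) (x : T) :
  Prop := forall z, S z -> (z <= x)%O.

Definition lt_set (d : Order.disp_t) (T : preorderType d) (y : T) (S : set T) :
  Prop := forall z, S z -> (y < z)%O.

(* The bound [y] may be [0-], in which case the set is empty. *)
Definition initial (d : Order.disp_t) (T : preorderType d) (y : star T) :
  set T := [set z | (to_star z <= y)%O].

Definition cdf (R : realType) (d : Order.disp_t) (T : tbPreorderType d)
    (F : T -> R) : Prop :=
  [/\ forall x, 0 <= F x <= 1,
      forall x y, (x <= y)%O -> F x <= F y
    & F \top%O = 1].

Definition cdf_star (R : realType) (d : Order.disp_t) (T : preorderType d)
    (F : T -> R) (x : star T) : R :=
  if x is Some a then F a else 0.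

Definition pbox (R : realType) (d : Order.disp_t) (T : tbPreorderType d)
    (Fl Fu : T -> R) : Prop :=
  [/\ cdf Fl, cdf Fu & forall x, Fl x <= Fu x].

Definition zero_one_valued (R : realType) (T : Type) (F : T -> R) : Prop :=
  forall x, F x = 0 \/ F x = 1.

(** Finitely additive probabilities on the full power set of [T]. *)
Definition fadd_probability (R : realType) (T : Type) (P : set T -> R) : Prop :=
  [/\ forall A, 0 <= P A,
      P setT = 1
    & forall A B, A `&` B = set0 -> P (A `|` B) = P A + P B].

Definition credal_set (R : realType) (d : Order.disp_t) (T : tbPreorderType d)
    (Fl Fu : T -> R) : set (set T -> R) :=
  [set P | fadd_probability P /\
           forall x : T, Fl x <= P (initial (to_star x)) <= Fu x].

Definition natural_extension (R : realType) (d : Order.disp_t)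
    (T : tbPreorderType d) (Fl Fu : T -> R) (A : set T) : R :=
  sup [set P A | P in credal_set Fl Fu].

Definition is_minimum (R : realType) (S : set R) (m : R) : Prop :=
  S m /\ lbound S m.

(* Main.v *)
(** Every admissible [P] gives full mass to [[0, y]] when [Fl y = 1], so
    [P A = P (A `&` [0, y])], which is at most [Fu x] for every [x] bounding
    [A `&` [0, y]].  Conversely, ultrafilters provide two kinds of 0-1-valued
    finitely additive probabilities: one escaping to the upper end of
    [A `&` B], and one concentrated at the lower end of the complement of [B].
    If [A] meets the complement of [B] arbitrarily low, the second kind can be
    placed on [A]; otherwise the mixture giving the first one the weight
    [inf Fu x] is admissible and attains the bound. *)
Require Import Defs.
From HB Require Import structures.
From mathcomp Require Import all_boot all_order all_algebra.
From mathcomp Require Import boolp classical_sets filter reals.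
From mathcomp Require Import lra.

Set Implicit Arguments.
Unset Strict Implicit.
Unset Printing Implicit Defensive.

Import Order.Theory GRing.Theory Num.Theory.

Local Open Scope classical_set_scope.
Local Open Scope ring_scope.

(** * Finitely additive probabilities and their construction from ultrafilters *)

Lemma fadd_probability0 (R : realType) (T : Type) (P : set T -> R) :
  fadd_probability P -> P set0 = 0.
Proof. by case=> _ _ /(_ set0 set0 (setI0 _)); rewrite setU0; lra. Qed.

Lemma fadd_probabilityD (R : realType) (T : Type) (P : set T -> R)
    (A C : set T) :
  fadd_probability P -> P A = P (A `&` C) + P (A `\` C).
Proof.
case=> _ _ <-; first by rewrite setUIDK.
by rewrite setDE setIACA setICr setI0.
Qed.

Lemma fadd_probability_le (R : realType) (T : Type) (P : set T -> R)
    (A C : set T) :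
  fadd_probability P -> A `<=` C -> P A <= P C.
Proof.
move=> hP /setIidr AsubC; rewrite (fadd_probabilityD C A hP) AsubC lerDl.
by case: hP.
Qed.

Lemma fadd_probability_le1 (R : realType) (T : Type) (P : set T -> R)
    (A : set T) :
  fadd_probability P -> P A <= 1.
Proof.
by move=> hP; case: (hP) => _ <- _; exact: fadd_probability_le.
Qed.

Lemma fadd_probabilityI (R : realType) (T : Type) (P : set T -> R)
    (A C : set T) :
  fadd_probability P -> 1 <= P C -> P A = P (A `&` C).
Proof.
move=> hP PC; rewrite (fadd_probabilityD A C hP).
have := fadd_probability_le hP (@subIsetr _ A (~` C)).
rewrite -setDE; have := fadd_probabilityD setT C hP.
rewrite setTI setTD; case: hP => P0 -> _; have := P0 (A `\` C); lra.
Qed.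

Lemma fadd_probability_mix (R : realType) (T : Type) (P Q : set T -> R)
    (m : R) :
  0 <= m <= 1 -> fadd_probability P -> fadd_probability Q ->
  fadd_probability (fun A => m * P A + (1 - m) * Q A).
Proof.
move=> /andP[m0 m1] [P0 P1 PD] [Q0 Q1 QD]; split=> [A||A C AC0].
- by rewrite addr_ge0// mulr_ge0 ?subr_ge0.
- by rewrite P1 Q1; lra.
- by rewrite PD// QD//; lra.
Qed.

(** Additivity holds because two disjoint sets cannot both belong to [U], while an ultrafilter
    containing a union contains one of its two members. *)
Lemma ultra_fadd_probability (R : realType) (T : Type) (U : set_system T) :
  UltraFilter U -> fadd_probability (fun A => (`[< U A >])%:R : R).
Proof.
move=> UU; split=> [A||A C AC0]; first exact: ler0n.
  by rewrite asboolT//; exact: filterT.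
case: (pselect (U A)) => UA; case: (pselect (U C)) => UC.
- have U0 : U set0 by rewrite -AC0; exact: filterI.
  by case: (filter_not_empty U U0).
- rewrite (asboolF UC) !asboolT ?addr0//.
  by apply: filterS UA; exact: subsetUl.
- rewrite (asboolF UA) !asboolT ?add0r//.
  by apply: filterS UC; exact: subsetUr.
- rewrite !asboolF ?addr0// => UAC.
  have [//|UA'] := in_ultra_setVsetC A UU.
  by apply: UC; apply: filterS (filterI UAC UA') => z [[]].
Qed.

(** The sets [C i] form a base of a proper filter, and any ultrafilter refining it gives them all
    mass 1. *)
Lemma exists_fadd_probability (R : realType) (T I : Type) (D : set I)
    (C : I -> set T) :
  (exists i, D i) ->
  (forall i j, D i -> D j -> exists2 k, D k & C k `<=` C i `&` C j) ->
  (forall i, D i -> C i !=set0) ->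
  exists2 P : set T -> R, fadd_probability P & forall i, D i -> P (C i) = 1.
Proof.
move=> D0 Cdir C0.
have [U [UU FU]] :=
  ultraFilterLemma (filter_from_proper (filter_from_filter D0 Cdir) C0).
exists (fun A => (`[< U A >])%:R); first exact: ultra_fadd_probability.
by move=> i Di; rewrite asboolT//; apply: FU; exists i.
Qed.

(** The common form of both infima in the theorem. Bounds range over [star T], so that an empty [C]
    is bounded by [0-] and gets a value at most 0. *)
Definition outer_cdf (R : realType) (d : Order.disp_t) (T : preorderType d)
    (F : T -> R) (C : set T) : R :=
  inf [set cdf_star F x | x in [set x | set_le [set to_star a | a in C] x]].

Section OuterCdf.
Context (R : realType) (d : Order.disp_t) (T : tbPreorderType d).
Implicit Types (F : T -> R) (C : set T) (x : star T).

Lemma cdf_star_ge0 F x : cdf F -> 0 <= cdf_star F x.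
Proof. by case: x => [a|] //= [/(_ a)/andP[]]. Qed.

Lemma outer_cdf_le F C x : cdf F -> (forall a, C a -> (to_star a <= x)%O) ->
  outer_cdf F C <= cdf_star F x.
Proof.
move=> hF Cx; apply: ge_inf; first by exists 0 => _ [z _ <-]; exact: cdf_star_ge0.
by exists x => // _ [a Ca <-]; exact: Cx.
Qed.

Lemma le_outer_cdf F C (m : R) :
  (forall x, (forall a, C a -> (to_star a <= x)%O) -> m <= cdf_star F x) ->
  m <= outer_cdf F C.
Proof.
move=> mF; apply: lb_le_inf.
  by exists (F \top%O), (Some \top%O) => // _ [a _ <-]; exact: lex1.
by move=> _ [x Cx <-]; apply: mF => a Ca; apply: Cx; exists a.
Qed.

Lemma outer_cdf_ge0 F C : cdf F -> 0 <= outer_cdf F C.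
Proof. by move=> hF; apply: le_outer_cdf => x _; exact: cdf_star_ge0. Qed.

Lemma outer_cdf_le1 F C : cdf F -> outer_cdf F C <= 1.
Proof.
move=> hF; case: (hF) => _ _ <-.
by apply: (@outer_cdf_le F C (Some \top%O)) => // a _; exact: lex1.
Qed.

End OuterCdf.

(** * Bounds on the credal set, and members that attain them *)

Section CredalSet.
Context (R : realType) (d : Order.disp_t) (Omega : tbPreorderType d).
Context (Fl Fu : Omega -> R) (hF : pbox Fl Fu).
Implicit Types (A C S : set Omega) (P : set Omega -> R).

Let cdfFl : cdf Fl. Proof. by case: hF. Qed.
Let cdfFu : cdf Fu. Proof. by case: hF. Qed.
Let leF x : Fl x <= Fu x. Proof. by case: hF. Qed.

Lemma credal_le_outer_cdf P C : credal_set Fl Fu P -> P C <= outer_cdf Fu C.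
Proof.
move=> [fP bP]; apply: le_outer_cdf => -[x|] Cx /=.
  have /andP[_] := bP x; apply: le_trans.
  exact: fadd_probability_le.
suff -> : C = set0 by rewrite fadd_probability0.
by apply/seteqP; split=> // a /Cx.
Qed.

Lemma credal_le_outer_cdf_initial P A y : credal_set Fl Fu P -> Fl y = 1 ->
  P A <= outer_cdf Fu (A `&` initial (to_star y)).
Proof.
move=> cP y1; have [fP bP] := cP.
rewrite (@fadd_probabilityI _ _ _ A (initial (to_star y)))//.
  exact: credal_le_outer_cdf.
by rewrite -y1; case/andP: (bP y).
Qed.

Lemma natural_extension_eq A (m : R) :
  (forall P, credal_set Fl Fu P -> P A <= m) ->
  (exists2 P, credal_set Fl Fu P & m <= P A) ->
  natural_extension Fl Fu A = m.
Proof.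
move=> Am [P cP mP]; apply/eqP; rewrite eq_le; apply/andP; split.
  by apply: ge_sup => [|_ [Q cQ <-]]; [exists (P A), P | exact: Am].
apply: le_trans mP _; apply: ub_le_sup; last by exists P.
by exists m => _ [Q cQ <-]; exact: Am.
Qed.

Hypothesis Omega_total : forall x y : Omega, (x <= y)%O \/ (y <= x)%O.

(** By totality the upper tails of [C] are directed, so some [P] gives mass 1 to each of them. An
    initial segment either contains [C], and then [outer_cdf Fu C] is at most [Fu x], or misses a
    tail and has mass 0. *)
Lemma exists_upper_end_probability C : C !=set0 ->
  exists2 P, fadd_probability P &
    P C = 1 /\
    forall x, outer_cdf Fu C * P (initial (to_star x)) <= Fu x.
Proof.
move=> [a0 Ca0].
have [|i j Ci Cj|i Ci|P fP PC] :=
  @exists_fadd_probability R Omega Omega C (fun a => C `&` [set z | (a <= z)%O]).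
- by exists a0.
- have [ij|ji] := Omega_total i j.
    by exists j => // z [Cz jz]; split; split=> //; exact: le_trans jz.
  by exists i => // z [Cz iz]; split; split=> //; exact: le_trans iz.
- by exists i; split=> //=; exact: lexx.
exists P => //; split.
  apply/eqP; rewrite eq_le fadd_probability_le1//= -(PC _ Ca0).
  exact: fadd_probability_le.
move=> x; case: (pselect (forall a, C a -> (a <= x)%O)) => Cx.
  apply: le_trans (outer_cdf_le (x := Some x) cdfFu Cx).
  by rewrite ler_piMr ?outer_cdf_ge0 ?fadd_probability_le1.
have /existsNP[a /not_implyP[Ca ax]] := Cx.
rewrite (fadd_probabilityI _ fP (C := C `&` [set z | (a <= z)%O])) ?PC//.
suff -> : initial (to_star x) `&` (C `&` [set z | (a <= z)%O]) = set0.
  by rewrite fadd_probability0// mulr0; exact: (cdf_star_ge0 (Some x)).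
by apply/seteqP; split=> // z [zx [_ /= az]]; apply: ax; exact: le_trans az zx.
Qed.

Hypothesis hFl : zero_one_valued Fl.

(** Here [P] lives on the traces on [S] of the segments [[0, y]] with [Fl y = 1]. A segment with
    [Fl x = 0] is disjoint from [S], hence the distribution function of [P] is exactly [Fl]. Leaving
    [S] free lets the mass be placed inside a given event. *)
Lemma exists_lower_end_probability S :
  (forall z, S z -> Fl z = 1) ->
  (forall y, Fl y = 1 -> exists2 z, S z & (z <= y)%O) ->
  exists2 P, fadd_probability P &
    P S = 1 /\ forall x, P (initial (to_star x)) = Fl x.
Proof.
move=> SFl Slow.
have top1 : Fl \top%O = 1 by case: cdfFl.
have [|i j Di Dj|i Di|P fP PS] :=
  @exists_fadd_probability R Omega Omega [set y | Fl y = 1]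
    (fun y => S `&` initial (to_star y)).
- by exists \top%O.
- have [ij|ji] := Omega_total i j.
    by exists i => // z [Sz zi]; split; split=> //; exact: le_trans ij.
  by exists j => // z [Sz zj]; split; split=> //; exact: le_trans ji.
- by have [z Sz zi] := Slow _ Di; exists z.
have P1 C y : Fl y = 1 -> S `&` initial (to_star y) `<=` C -> P C = 1.
  move=> y1 SC; apply/eqP; rewrite eq_le fadd_probability_le1//= -(PS _ y1).
  exact: fadd_probability_le.
have PS1 : P S = 1 by apply: P1 top1 _; exact: subIsetl.
exists P => //; split=> // x; have [x0|x1] := hFl x; last first.
  by rewrite x1; apply: P1 x1 _; exact: subIsetr.
rewrite x0 (fadd_probabilityI _ fP (C := S)) ?PS1//.
suff -> : initial (to_star x) `&` S = set0 by exact: fadd_probability0.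
apply/seteqP; split=> // z [zx /SFl z1].
by case: cdfFl => _ /(_ _ _ zx) + _; rewrite z1 x0 ler10.
Qed.

Lemma credal_attains1 A :
  (forall y, Fl y = 1 -> exists2 z, (A z /\ Fl z = 1) & (z <= y)%O) ->
  exists2 P, credal_set Fl Fu P & 1 <= P A.
Proof.
move=> /(exists_lower_end_probability
  (S := [set z | A z /\ Fl z = 1]))[_ []//|P fP [PS PFl]].
exists P; first by split=> // x; rewrite PFl lexx leF.
by rewrite -PS; apply: fadd_probability_le => // z [].
Qed.

(** Mix the upper-end [P] of [C], weighted by [m], with a lower-end [Q]. Where [Fl x = 0], [Q]
    vanishes on [[0, x]] and [m * P] stays below [Fu x]; where [Fl x = 1], the segment contains [C],
    so both give it mass 1. *)
Lemma credal_attains_outer_cdf C : (forall z, C z -> Fl z = 0) ->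
  exists2 P, credal_set Fl Fu P & outer_cdf Fu C <= P C.
Proof.
move=> C0; set m := outer_cdf Fu C.
have m0 : 0 <= m by exact: outer_cdf_ge0.
have m1 : m <= 1 by exact: outer_cdf_le1.
have [//|y y1|Q fQ [_ QFl]] :=
  exists_lower_end_probability (S := [set z | Fl z = 1]).
  by exists y; last exact: lexx.
case: (pselect (C !=set0)) => [/exists_upper_end_probability[P fP [PC PFu]]|CN0].
  exists (fun A => m * P A + (1 - m) * Q A); last first.
    by rewrite PC mulr1 lerDl mulr_ge0 ?subr_ge0//; case: fQ.
  split; first by apply: fadd_probability_mix => //; rewrite m0.
  move=> x; rewrite QFl; have [x0|x1] := hFl x.
    rewrite x0 mulr0 addr0 PFu andbT mulr_ge0//; by case: fP.
  suff -> : P (initial (to_star x)) = 1.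
    by rewrite x1 !mulr1 addrC subrK lexx -x1 leF.
  apply/eqP; rewrite eq_le fadd_probability_le1//= -PC.
  apply: fadd_probability_le => // z /C0 z0.
  have [//|xz] := Omega_total z x.
  by case: cdfFl => _ /(_ _ _ xz) + _; rewrite x1 z0 ler10.
(* For empty [C] there is no upper end to escape to, but [0-] bounds [C], so [m <= 0] and [Q] alone
   suffices. *)
exists Q; first by split=> // x; rewrite QFl lexx leF.
case: (fQ) => Q0 _ _; apply: le_trans (Q0 C).
by apply: (outer_cdf_le (x := None)) => // a Ca; case: CN0; exists a.
Qed.

End CredalSet.

Theorem proposition7 (R : realType) (d : Order.disp_t)
    (Omega : tbPreorderType d)
    (Omega_total : forall x y : Omega, (x <= y)%O \/ (y <= x)%O)
    (Fl Fu : Omega -> R) (hF : pbox Fl Fu) (hFl : zero_one_valued Fl)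
    (A : set Omega) :
  let B : set (star Omega) := [set x | cdf_star Fl x = 0] in
  let Bc : set (star Omega) := ~` B in
  let As : set (star Omega) := [set to_star a | a in A] in
  natural_extension Fl Fu A =
    (if `[< exists2 y : star Omega, Bc y & lt_set y (As `&` Bc) >]
     then inf [set cdf_star Fu x | x in [set x | set_le (As `&` B) x]]
     else 1)
  /\
  is_minimum
    [set inf [set cdf_star Fu x | x in
                [set x | set_le [set to_star a | a in A `&` initial y] x]]
      | y in Bc]
    (natural_extension Fl Fu A).
Proof.
move=> B Bc As.
have [[_ Flm Fl1] cdfFu _] := hF.
have Bc1 (a : Omega) : Bc (Some a) <-> Fl a = 1.
  split=> [|a1]; first by have [a0 /(_ a0)|//] := hFl a.
  by rewrite /Bc /B /= a1; exact/eqP/oner_neq0.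
have BcN : ~ Bc None by apply.
have BcP y : Bc y -> exists2 b, y = Some b & Fl b = 1.
  by case: y => [b /Bc1|/BcN//]; exists b.
have le_outer P y : credal_set Fl Fu P -> Bc y ->
    P A <= outer_cdf Fu (A `&` initial y).
  by move=> cP /BcP[b -> b1]; exact: (credal_le_outer_cdf_initial A cP b1).
(* By [le_outer], a credal [P] with [m <= P A] makes [m] a lower bound over all of [Bc]; one [y]
   whose infimum is at most [m] then attains the minimum. *)
suff [m [Em mE [y Bcy my]]] : exists m, [/\ natural_extension Fl Fu A = m,
    m = (if `[< exists2 y : star Omega, Bc y & lt_set y (As `&` Bc) >]
         then inf [set cdf_star Fu x | x in [set x | set_le (As `&` B) x]]
         else 1)
    & exists2 y, Bc y & outer_cdf Fu (A `&` initial y) <= m /\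
                        exists2 P, credal_set Fl Fu P & m <= P A].
  case: my => ym [P cP mP]; split; first by rewrite Em.
  split.
    exists y => //; apply/eqP; rewrite eq_le Em ym /=.
    exact: le_trans mP (le_outer _ _ cP Bcy).
  move=> _ [z Bcz <-]; rewrite Em.
  exact: le_trans mP (le_outer _ _ cP Bcz).
case: asboolP => [[y Bcy yA]|noy].
  set C : set Omega := A `&` [set z | Fl z = 0].
  have AsB : As `&` B = [set to_star a | a in C].
    by apply/seteqP; split=> [_ [[a Aa <-] Ba]|_ [a [Aa a0] <-]];
      [exists a | split=> //; exists a].
  (* Since [y] is strictly below [A] outside [B], cutting [A] at [y] removes exactly that part; by
     totality and monotonicity of [Fl], the points of [B] all lie below [y]. *)
  have Ay : A `&` initial y = C.
    have [b yb b1] := BcP _ Bcy; rewrite yb in yA *.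
    apply/seteqP; split=> z [Az zb]; split=> //=.
      have [//|z1] := hFl z.
      have /yA : (As `&` Bc) (Some z) by split; [exists z | exact/Bc1].
      by rewrite lt_leAnge => /andP[_ /negP].
    have [//|bz] := Omega_total z b.
    by have := Flm _ _ bz; rewrite b1 (zb : Fl z = 0) ler10.
  have [z []//|P cP mP] := credal_attains_outer_cdf hF Omega_total hFl (C := C).
  have PA : outer_cdf Fu C <= P A.
    by apply: le_trans mP _; apply: fadd_probability_le cP.1 (@subIsetl _ _ _).
  exists (outer_cdf Fu C); split; last 1 first.
  - by exists y => //; split; [rewrite Ay | exists P].
  - apply: natural_extension_eq; last by exists P.
    by move=> Q cQ; rewrite -Ay; exact: le_outer.
  - by rewrite AsB.
(* By totality, the failure of every [b] to lie strictly below [A] outside [B] yields a point of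
   that set below each [b]. *)
have [b b1|P cP PA] := credal_attains1 hF Omega_total hFl (A := A).
  apply: contrapT => nz; apply: noy; exists (Some b); first exact/Bc1.
  move=> _ [[z Az <-] /Bc1 z1].
  have nzb : ~ (z <= b)%O by move=> zb; apply: nz; exists z.
  have [//|bz] := Omega_total z b.
  by rewrite lt_leAnge; apply/andP; split=> //; exact/negP.
exists 1; split=> //.
  apply: natural_extension_eq; last by exists P.
  by move=> Q [fQ _]; exact: fadd_probability_le1.
(* Any [y] in [Bc] would do, as every [outer_cdf] is at most 1; the top element is certainly
   there. *)
by exists (Some \top%O); [exact/Bc1 | split; [exact: outer_cdf_le1 | exists P]].
Qed.
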